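(* Let $Q$ be a prime power, let $n,k$ be integers with $n>0$ and $k\ge 0$, and let $\beta,\delta\in\mathbb{F}_{Q^2}$ satisfy $\beta^{Q+1}=1$ and $\delta\notin\mathbb{F}_Q$. Then the polynomial \[ f(x):=x^{n+k(Q+1)} \cdot \left((\delta x^{Q-1}-\beta \delta^Q)^n - \delta(x^{Q-1}-\beta)^n\right) \] permutes $\mathbb{F}_{Q^2}$ (i.e., the map $\alpha\mapsto f(\alpha)$ is a bijection of $\mathbb{F}_{Q^2}$) if and only if $\gcd(n(n+2k),Q-1)=1$. *)

(* Defs.v *)
From HB Require Import structures.
From mathcomp Require Import all_boot all_order all_algebra all_field.

Set Implicit Arguments.
Unset Strict Implicit.
Unset Printing Implicit Defensive.

Import GRing.Theory.
Local Open Scope ring_scope.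

Definition prime_power (q : nat) : Prop :=
  exists p m : nat, [/\ prime p, (0 < m)%N & q = (p ^ m)%N].

(* A finite field has at most one such K, so for #|F| = q ^ 2 this pins down the
   copy of F_q inside F, namely the set of roots of 'X^q - 'X. *)
Definition subfield_of_order (F : finFieldType) (q : nat) (K : {set F}) : Prop :=
  divring_closed K /\ #|K| = q.

Definition permutes (F : finFieldType) (f : {poly F}) : Prop :=
  bijective (fun a : F => f.[a]).

(* Main.v *)
Require Import Defs.
From HB Require Import structures.
From mathcomp Require Import all_boot all_order all_algebra all_field.
From mathcomp Require Import ring.

Import GRing.Theory.
Local Open Scope ring_scope.

(** Write [N x = x ^+ (Q + 1)], [u x = delta x^Q - beta delta^Q x] and
    [v x = x^Q - beta x].  Then [f x = N(x)^k (u(x)^n - delta v(x)^n)] on all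
    of [F].  Both [u] and [v] take values in the line
    [y^Q = - beta^-1 y] over F_Q, and [x |-> (u x, v x)] is an F_Q-linear
    isomorphism onto the square of that line.  As [1, delta] is an F_Q-basis of
    [F], [f] is equivalent to [(a, b) |-> N(a - delta b)^k (a^n, b^n)] on F_Q^2,
    which is homogeneous of degree [n + 2 k].  The ratio [a : b] is recovered
    iff [n] is prime to [Q - 1], the scale iff [n + 2 k] is. *)

(** * Root extraction with exponents prime to the order *)

(** Bezout gives [j * m = l * N + 1], so raising to the [j] inverts the [m]-th power map on the
    [N]-th roots of unity. *)
Lemma coprime_exprK (R : nzRingType) (m N : nat) :
  (0 < m)%N -> coprime m N ->
  exists j, forall s : R, s ^+ N = 1 -> (s ^+ j) ^+ m = s.
Proof.
move=> m0 /eqP coNm; case: (egcdnP N m0) => j l jE _.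
by exists j => s sN; rewrite -exprM jE coNm exprD mulnC exprM sN expr1n mul1r expr1.
Qed.

Lemma coprime_expr_eq1 (R : nzRingType) (m N : nat) (s : R) :
  (0 < m)%N -> coprime m N -> s ^+ N = 1 -> s ^+ m = 1 -> s = 1.
Proof.
move=> m0 co sN sm; have [j /(_ s sN) <-] := coprime_exprK R m N m0 co.
by rewrite exprAC sm expr1n.
Qed.

(** * Subfields and roots of unity in a finite field *)

Section FiniteFieldPowers.

Variable F : finFieldType.

(** Multiplication by a nonzero [x] in [K] permutes the nonzero elements of [K]; comparing their
    products gives [x ^+ (#|K| - 1) = 1]. *)
Lemma divring_closed_expf_card (K : {set F}) (x : F) :
  divring_closed K -> x \in K -> x ^+ #|K| = x.
Proof.
move=> [K1 KB KV] xK; have [->|x0] := eqVneq x 0.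
  by rewrite expr0n; case: #|K| (cardsD1 1 K) => //; rewrite K1.
have K0 : 0 \in K by rewrite -(subrr 1) KB.
have KM y z : y \in K -> z \in K -> y * z \in K.
  (* [divring_closed] provides differences and quotients only, so a product is written as a
     quotient. *)
  move=> yK zK; have -> : y * z = y / (1 / z) by rewrite div1r invrK.
  by rewrite !KV.
have prod_neq0 : \prod_(y in K :\ 0) y != 0.
  by apply/prodf_neq0 => y /setD1P[].
have memK y : (x * y \in K :\ 0) = (y \in K :\ 0).
  rewrite !in_setD1 mulf_eq0 negb_or x0 /=; congr (_ && _).
  apply/idP/idP => yK; last exact: KM.
  by rewrite -[y](mulKf x0) mulrC KV.
have : \prod_(y in K :\ 0) y = \prod_(y in K :\ 0) (x * y).
  by rewrite (reindex_inj (mulfI x0)) /=; apply: eq_bigl.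
rewrite big_split /= prodr_const => /eqP.
rewrite -{1}[\prod_(y in _) y]mul1r (inj_eq (mulIf prod_neq0)) => /eqP xE.
by rewrite (cardsD1 0) K0 exprS -xE mulr1.
Qed.

(** All of [K] consists of roots of ['X^#|K| - 'X]; a root outside [K] would be one more than the
    degree allows. *)
Lemma mem_divring_closed (K : {set F}) (x : F) :
  divring_closed K -> (x \in K) = (x ^+ #|K| == x).
Proof.
move=> clK; apply/idP/eqP => [|xE]; first exact: divring_closed_expf_card.
have K_gt1 : (1 < #|K|)%N.
  case: (clK) => K1 KB _; have K0 : 0 \in K by rewrite -(subrr 1) KB.
  by rewrite (cardsD1 0) K0 (cardsD1 1) !inE oner_eq0 K1.
apply/negPn/negP => xK.
have sizeP : size ('X^#|K| - 'X : {poly F}) = #|K|.+1.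
  by rewrite size_polyDl size_polyXn // size_polyN size_polyX.
have rootP : all (root ('X^#|K| - 'X)) (enum (x |: K)).
  apply/allP => y; rewrite mem_enum => /setU1P yxK.
  apply/rootP; rewrite !hornerE; apply/eqP; rewrite subr_eq0; apply/eqP.
  by case: yxK => [-> //|yK]; apply: divring_closed_expf_card.
have := max_poly_roots _ rootP (enum_uniq _).
rewrite -size_poly_eq0 sizeP -cardE cardsU1 xK add1n ltnn.
by move=> /(_ isT).
Qed.

(** Write [#|F| - 1 = e * d]. Since ['X^e - 1] has at most [e < e * d] roots, some nonzero [y] has
    [y ^+ e != 1], and [y ^+ e] is the root sought. *)
Lemma unity_root_neq1 (d : nat) :
  (1 < d)%N -> (d %| #|F|.-1)%N -> exists2 z : F, z != 1 & z ^+ d = 1.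
Proof.
move=> d1 /dvdnP[e eE].
have cardF : #|F|.-1.+1 = #|F| by rewrite prednK // ltnW // card_finNzRing_gt1.
have e0 : (0 < e)%N.
  have : (0 < #|F|.-1)%N by rewrite -ltnS cardF card_finNzRing_gt1.
  by rewrite eE muln_gt0 => /andP[].
have [/forall_inP all1|] := boolP [forall (y : F | y != 0), y ^+ e == 1]; last first.
  rewrite negb_forall_in => /existsP[y /andP[y0 y1]]; exists (y ^+ e) => //.
  by rewrite -exprM -eE; apply: (mulfI y0); rewrite -exprS cardF expf_card mulr1.
have rootP : all (root ('X^e - 1%:P)) (enum [set~ (0 : F)]).
  apply/allP => y; rewrite mem_enum !inE => y0.
  by rewrite /root !hornerE subr_eq0; apply: all1.
have := max_poly_roots _ rootP (enum_uniq _).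
rewrite -size_poly_eq0 size_XnsubC // -cardE cardsC1 eE ltnS => /(_ isT).
by rewrite leqNgt ltn_Pmulr.
Qed.

End FiniteFieldPowers.

(** * The forms [u] and [v] as coordinates over F_Q *)

Section TwistedForms.

Variables (F : fieldType) (Q : nat) (beta delta : F).
Hypothesis frobD : {morph (fun x : F => x ^+ Q) : x y / x + y}.
Hypothesis frobK : forall x : F, (x ^+ Q) ^+ Q = x.
Hypothesis betaQ : beta ^+ Q * beta = 1.
Hypothesis deltaQ : delta ^+ Q != delta.

Lemma frob0 : (0 : F) ^+ Q = 0.
Proof. by apply: (addrI (0 ^+ Q)); rewrite -frobD !addr0. Qed.

Lemma frobN (x : F) : (- x) ^+ Q = - x ^+ Q.
Proof. by apply: (addrI (x ^+ Q)); rewrite -frobD !subrr frob0. Qed.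

Lemma beta_neq0 : beta != 0.
Proof.
by apply/eqP => b0; have /eqP := betaQ; rewrite b0 mulr0 eq_sym oner_eq0.
Qed.

(** Common shape of [u] ([a = delta]) and [v] ([a = 1]). With [w = a * x ^+ Q] it is
    [w - beta * w ^+ Q], which explains why all values lie on one line over F_Q. *)
Definition twisted_form (a x : F) := a * x ^+ Q - beta * a ^+ Q * x.

Lemma twisted_form_frob (a x : F) :
  twisted_form a x ^+ Q = - beta ^+ Q * twisted_form a x.
Proof.
rewrite /twisted_form frobD frobN !exprMn !frobK.
have -> : a ^+ Q * x = beta ^+ Q * beta * (a ^+ Q * x) by rewrite betaQ mul1r.
by ring.
Qed.

Lemma twisted_formZ (a t x : F) :
  t ^+ Q = t -> twisted_form a (t * x) = t * twisted_form a x.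
Proof. by rewrite /twisted_form exprMn => ->; ring. Qed.

(** The terms in [x ^+ Q] cancel. What remains is a nonzero multiple of [x], so the two forms
    together determine [x]. *)
Lemma twisted_form_comb (x : F) :
  twisted_form delta x - delta * twisted_form 1 x
    = beta * (delta - delta ^+ Q) * x.
Proof. by rewrite /twisted_form expr1n; ring. Qed.

Lemma twisted_form_inj (x y : F) :
  twisted_form delta x = twisted_form delta y ->
  twisted_form 1 x = twisted_form 1 y -> x = y.
Proof.
move=> ux vx; have := twisted_form_comb x.
rewrite ux vx twisted_form_comb => /mulfI -> //.
by rewrite mulf_neq0 ?beta_neq0 // subr_eq0 eq_sym.
Qed.

Lemma twisted_form_surj (l a b : F) :
  l ^+ Q = - beta ^+ Q * l -> a ^+ Q = a -> b ^+ Q = b ->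
  exists x, twisted_form delta x = a * l /\ twisted_form 1 x = b * l.
Proof.
move=> lQ aQ bQ; pose d := delta - delta ^+ Q.
have d0 : d != 0 by rewrite subr_eq0 eq_sym.
have dQ : d ^+ Q = - d by rewrite /d frobD frobN frobK opprB.
have dVQ : d^-1 ^+ Q = - d^-1 by rewrite exprVn dQ invrN.
(* Solves [beta * d * x = (a - delta * b) * l], as forced by [twisted_form_comb], with [beta ^+ Q]
   in place of the inverse of [beta]. *)
pose x := (a - delta * b) * (beta ^+ Q * l) / d; exists x.
have xQ : x ^+ Q = (a - delta ^+ Q * b) * l / d.
  rewrite /x !exprMn dVQ frobD frobN exprMn aQ bQ frobK lQ.
  have -> : (a - delta ^+ Q * b) * l / d =
    (beta ^+ Q * beta) * ((a - delta ^+ Q * b) * l / d) by rewrite betaQ mul1r.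
  by ring.
have bx : beta * x = (a - delta * b) * l / d.
  rewrite /x; have -> : (a - delta * b) * l / d =
    (beta ^+ Q * beta) * ((a - delta * b) * l / d) by rewrite betaQ mul1r.
  by ring.
rewrite /twisted_form expr1n mulr1 mul1r [beta * _ * x]mulrAC bx xQ.
by move: d0; rewrite /d => d0; split; field.
Qed.

(** By [twisted_form_comb] at 1, the two forms cannot both vanish there. *)
Lemma twisted_form_gen : exists2 l, l != 0 & l ^+ Q = - beta ^+ Q * l.
Proof.
have [v0|v0] := eqVneq (twisted_form 1 1) 0; last first.
  by exists (twisted_form 1 1) => //; apply: twisted_form_frob.
exists (twisted_form delta 1); last exact: twisted_form_frob.
have := twisted_form_comb 1; rewrite v0 mulr0 subr0 mulr1 => ->.
by rewrite mulf_neq0 ?beta_neq0 // subr_eq0 eq_sym.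
Qed.

Lemma frob_fixP (t : F) :
  (0 < Q)%N -> t != 0 -> (t ^+ Q = t) <-> (t ^+ (Q - 1) = 1).
Proof.
move=> Q0 t0; rewrite -{1}(subnK Q0) addn1 exprS; split=> [tQ|->]; last exact: mulr1.
by apply: (mulfI t0); rewrite tQ mulr1.
Qed.

(** If [B] were nonzero, [A / B = delta] would be fixed by the Frobenius map, as [A] and [B] are
    multiplied by the same [c]. *)
Lemma twisted_basis (c A B : F) :
  c != 0 -> A ^+ Q = c * A -> B ^+ Q = c * B -> A = delta * B ->
  A = 0 /\ B = 0.
Proof.
move=> c0 AQ BQ AE.
have B0 : B = 0.
  apply/eqP; have := AQ; rewrite AE exprMn BQ mulrCA => /(mulfI c0) /eqP.
  by rewrite -subr_eq0 -mulrBl mulf_eq0 subr_eq0 (negPf deltaQ).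
by rewrite AE B0 mulr0.
Qed.

End TwistedForms.

(** * Injectivity of the map and the two coprimality conditions *)

Section Permutation.

Variables (F : finFieldType) (Q n k : nat) (beta delta : F).
Hypothesis Q_gt1 : (1 < Q)%N.
Hypothesis n_gt0 : (0 < n)%N.
Hypothesis cardF : #|F| = (Q ^ 2)%N.
Hypothesis frobD : {morph (fun x : F => x ^+ Q) : x y / x + y}.
Hypothesis betaQ : beta ^+ Q * beta = 1.
Hypothesis deltaQ : delta ^+ Q != delta.

Local Notation u := (twisted_form F Q beta delta).
Local Notation v := (twisted_form F Q beta 1).
Local Notation norm x := (x ^+ Q * x).

Definition twisted_power (x : F) := norm x ^+ k * (u x ^+ n - delta * v x ^+ n).
Local Notation g := twisted_power.

Let Q_gt0 : (0 < Q)%N := ltnW Q_gt1.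

Let frobK (x : F) : (x ^+ Q) ^+ Q = x.
Proof. by rewrite -exprM mulnn -cardF expf_card. Qed.

Let norm_frob (x : F) : norm x ^+ Q = norm x.
Proof. by rewrite exprMn frobK mulrC. Qed.

Let norm_neq0 (x : F) : x != 0 -> norm x != 0.
Proof. by move=> x0; rewrite mulf_neq0 ?expf_neq0. Qed.

Lemma twisted_powerZ (t x : F) :
  t ^+ Q = t -> g (t * x) = t ^+ (n + 2 * k) * g x.
Proof.
move=> tQ; rewrite /g !twisted_formZ // !exprMn tQ exprD exprM expr2 !exprMn.
by ring.
Qed.

(** Both coordinates lie on the line [z ^+ Q = (- beta ^+ Q) ^+ n * z], so [twisted_basis] applies
    to their differences. *)
Lemma twisted_power_eq (x y : F) : g x = g y ->
  norm x ^+ k * u x ^+ n = norm y ^+ k * u y ^+ n /\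
  norm x ^+ k * v x ^+ n = norm y ^+ k * v y ^+ n.
Proof.
move=> gxy.
have c0 : (- beta ^+ Q) ^+ n != 0.
  by rewrite expf_neq0 // oppr_eq0 expf_neq0 // (beta_neq0 _ Q).
have frobT a z : (norm z ^+ k * twisted_form F Q beta a z ^+ n) ^+ Q
    = (- beta ^+ Q) ^+ n * (norm z ^+ k * twisted_form F Q beta a z ^+ n).
  rewrite exprMn [(_ ^+ k) ^+ Q]exprAC [(_ ^+ n) ^+ Q]exprAC norm_frob.
  by rewrite twisted_form_frob // [(- _ * _) ^+ n]exprMn mulrCA.
have frobTB a : (norm x ^+ k * twisted_form F Q beta a x ^+ n
      - norm y ^+ k * twisted_form F Q beta a y ^+ n) ^+ Q
    = (- beta ^+ Q) ^+ n * (norm x ^+ k * twisted_form F Q beta a x ^+ n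
      - norm y ^+ k * twisted_form F Q beta a y ^+ n).
  by rewrite frobD frobN // !frobT mulrBr.
have [] := twisted_basis F Q delta deltaQ _ _ _ c0 (frobTB delta) (frobTB 1).
  apply/eqP; rewrite -subr_eq0; apply/eqP.
  by rewrite -(subrr (g y)) -{1}gxy /g; ring.
by move=> /subr0_eq uE /subr0_eq vE.
Qed.

Let twisted_form0 (a : F) : twisted_form F Q beta a 0 = 0.
Proof. by rewrite /twisted_form frob0 // !mulr0 subr0. Qed.

Lemma twisted_power0 : g 0 = 0.
Proof. by rewrite /g !twisted_form0 [0 ^+ n]expr0n gtn_eqF // !mulr0 subrr mulr0. Qed.

Lemma twisted_power_eq0 (x : F) : g x = 0 -> x = 0.
Proof.
rewrite -{1}twisted_power0 => /twisted_power_eq[].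
rewrite !twisted_form0 !expr0n !(gtn_eqF n_gt0) !mulr0 => /eqP + /eqP.
have [//|x0] := eqVneq x 0.
rewrite !mulf_eq0 !(negPf (expf_neq0 _ (norm_neq0 _ x0))) !expf_eq0 n_gt0 /=.
move=> /eqP ux /eqP vx.
by apply: (twisted_form_inj F Q beta delta) => //; rewrite ?ux ?vx twisted_form0.
Qed.

Lemma twisted_power_inj :
  coprime n (Q - 1) -> coprime (n + 2 * k) (Q - 1) -> injective g.
Proof.
move=> co_n co_nk x y gxy; have [y0|y0] := eqVneq y 0.
  by rewrite y0 in gxy *; apply: twisted_power_eq0; rewrite gxy twisted_power0.
have [x0|x0] := eqVneq x 0.
  by case/eqP: y0; apply: twisted_power_eq0; rewrite -gxy x0 twisted_power0.
have [uE vE] := twisted_power_eq _ _ gxy.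
(* By [uE] and [vE], the [n]-th powers of both forms at [x] are [s] times those at [y]; [r] below is
   an [n]-th root of [s] in F_Q. *)
pose s := (norm y / norm x) ^+ k.
have s0 : s != 0 by rewrite expf_neq0 // mulf_neq0 ?invr_eq0 ?norm_neq0.
have sQ : s ^+ Q = s by rewrite exprAC exprMn exprVn !norm_frob.
have [j /(_ s) jE] := coprime_exprK F n (Q - 1) n_gt0 co_n.
have {}jE : (s ^+ j) ^+ n = s by apply/jE/frob_fixP.
pose r := s ^+ j.
have r0 : r != 0 by apply: expf_neq0.
have rQ : r ^+ Q = r by rewrite exprAC sQ.
(* a ratio of two values of the same form lies in F_Q, where n-th roots are unique *)
have formE a : norm x ^+ k * twisted_form F Q beta a x ^+ n
      = norm y ^+ k * twisted_form F Q beta a y ^+ n ->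
    twisted_form F Q beta a x = r * twisted_form F Q beta a y.
  set w := twisted_form F Q beta a x; set z := twisted_form F Q beta a y.
  move=> wzE; have {}wzE : w ^+ n = (r * z) ^+ n.
    rewrite exprMn jE /s exprMn exprVn; apply: (mulfI (expf_neq0 k (norm_neq0 _ x0))).
    by rewrite wzE; field; rewrite expf_neq0 ?norm_neq0.
  have [z0|z0] := eqVneq z 0.
    move/eqP: wzE; rewrite z0 mulr0 expr0n gtn_eqF // expf_eq0 n_gt0 /=.
    by move=> /eqP.
  have rz0 : r * z != 0 by rewrite mulf_neq0.
  have w0 : w != 0 by have := expf_neq0 n rz0; rewrite -wzE expf_eq0 n_gt0.
  have wz0 : w / (r * z) != 0 by rewrite mulf_neq0 ?invr_eq0.
  apply: (divIf rz0); rewrite divff //.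
  apply: (coprime_expr_eq1 F n (Q - 1)) => //; last first.
    by rewrite exprMn exprVn wzE divff // expf_neq0.
  apply/frob_fixP => //; rewrite exprMn exprVn exprMn rQ !twisted_form_frob //.
  by rewrite -/w -/z; field; rewrite z0 r0 oppr_eq0 expf_neq0 // (beta_neq0 _ Q).
have xE : x = r * y.
  by apply: (twisted_form_inj F Q beta delta) => //; rewrite twisted_formZ // formE.
(* Homogeneity turns [g x = g y] into [r ^+ (n + 2 * k) = 1]. *)
have r1 : r = 1.
  apply: (coprime_expr_eq1 F (n + 2 * k) (Q - 1)) => //.
  - by rewrite addn_gt0 n_gt0.
  - exact/frob_fixP.
  have gy0 : g y != 0 by apply: contra_neq y0; apply: twisted_power_eq0.
  by apply: (mulIf gy0); rewrite -twisted_powerZ // -xE mul1r.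
by rewrite xE r1 mul1r.
Qed.

Let unity_root_fixed (m : nat) : (0 < m)%N -> ~~ coprime m (Q - 1) ->
  exists z : F, [/\ z != 1, z ^+ Q = z & z ^+ m = 1].
Proof.
move=> m0 nco; pose d := gcdn m (Q - 1).
have d_gt1 : (1 < d)%N by rewrite ltn_neqAle eq_sym nco gcdn_gt0 m0.
have [||z z1 zd] := unity_root_neq1 F d => //.
  rewrite cardF -subn1 -[X in (_ - X)%N](exp1n 2) subn_sqr dvdn_mulr //.
  exact: dvdn_gcdr.
have dvd1 e : (d %| e)%N -> z ^+ e = 1.
  by move=> /dvdnP[c ->]; rewrite mulnC exprM zd expr1n.
exists z; split=> //; last by rewrite dvd1 // dvdn_gcdl.
apply/frob_fixP => //; last by rewrite dvd1 // dvdn_gcdr.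
by apply/eqP => z0; move: zd => /eqP; rewrite z0 expr0n gtn_eqF 1?ltnW // eq_sym oner_eq0.
Qed.

(** A root of unity [z != 1] in F_Q of exponent [n + 2 * k] gives [g z = g 1]. One of exponent [n]
    gives points with coordinates [(1, 1)] and [(1, z)] whose images differ only by a norm factor in
    F_Q, which scaling absorbs once [n + 2 * k] is known to be prime to [Q - 1]. *)
Lemma twisted_power_inj_coprime :
  injective g -> coprime n (Q - 1) /\ coprime (n + 2 * k) (Q - 1).
Proof.
move=> g_inj; have nk_gt0 : (0 < n + 2 * k)%N by rewrite addn_gt0 n_gt0.
have co_nk : coprime (n + 2 * k) (Q - 1).
  apply/negPn/negP => /(unity_root_fixed _ nk_gt0)[z [z1 zQ zE]].
  case/eqP: z1; apply: g_inj.
  by rewrite -[z in LHS]mulr1 twisted_powerZ // zE mul1r.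
split=> //; apply/negPn/negP => /(unity_root_fixed _ n_gt0)[z [z1 zQ zE]].
have one_frob : (1 : F) ^+ Q = 1 by rewrite expr1n.
have [l l0 lQ] := twisted_form_gen F Q beta delta frobD frobK betaQ deltaQ.
have surj := twisted_form_surj F Q beta delta frobD frobK betaQ deltaQ l.
have [x [ux vx]] := surj 1 1 lQ one_frob one_frob.
have [y [uy vy]] := surj 1 z lQ one_frob zQ.
have form_neq0 w : u w = 1 * l -> w != 0.
  by move=> uw; apply: contra_neq l0 => w0; rewrite -[l]mul1r -uw w0 twisted_form0.
have x0 := form_neq0 _ ux; have y0 := form_neq0 _ uy.
pose s := (norm x / norm y) ^+ k.
have s0 : s != 0 by rewrite expf_neq0 // mulf_neq0 ?invr_eq0 ?norm_neq0.
have sQ : s ^+ Q = s by rewrite exprAC exprMn exprVn !norm_frob.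
have [j /(_ s) jE] := coprime_exprK F (n + 2 * k) (Q - 1) nk_gt0 co_nk.
have {}jE : (s ^+ j) ^+ (n + 2 * k) = s by apply/jE/frob_fixP.
pose t := s ^+ j.
have tQ : t ^+ Q = t by rewrite exprAC sQ.
have xE : x = t * y.
  apply: g_inj; rewrite twisted_powerZ // jE /g ux uy vx vy !mul1r [(z * l) ^+ n]exprMn zE mul1r.
  by rewrite /s expr_div_n; field; rewrite expf_neq0 ?norm_neq0.
(* The equal first coordinates force the scale to be 1; the second ones then give [z = 1]. *)
have t1 : t = 1.
  by apply: (mulIf l0); rewrite -ux xE twisted_formZ // uy mul1r.
case/eqP: z1; apply: (mulIf l0).
by rewrite -vy -vx xE t1 mul1r.
Qed.

End Permutation.

(** * From the polynomial to the map on the field *)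

Theorem theorem1p2 (Q : nat) (hQ : prime_power Q)
  (F : finFieldType) (hF : #|F| = (Q ^ 2)%N)
  (FQ : {set F}) (hFQ : subfield_of_order Q FQ)
  (n k : nat) (hn : (0 < n)%N)
  (beta delta : F) (hbeta : beta ^+ (Q + 1) = 1) (hdelta : delta \notin FQ) :
  permutes ('X^(n + k * (Q + 1)) *
            ((delta *: 'X^(Q - 1) - (beta * delta ^+ Q)%:P) ^+ n
             - delta *: ('X^(Q - 1) - beta%:P) ^+ n))
  <-> gcdn (n * (n + 2 * k)) (Q - 1) = 1%N.
Proof.
case: hQ => p [m [p_prime m_gt0 QE]]; case: hFQ => FQ_closed FQ_card.
have Q_gt1 : (1 < Q)%N by rewrite QE -(expn0 p) ltn_exp2l // prime_gt1.
have p_char : p \in [pchar F].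
  by apply: (@card_finPcharP _ _ (m * 2)) => //; rewrite hF QE -expnM.
have frobD : {morph (fun x : F => x ^+ Q) : x y / x + y}.
  move=> x y; apply: exprDn_pchar; rewrite QE pnatX.
  by apply/orP; left; rewrite pnatE.
have betaQ : beta ^+ Q * beta = 1 by rewrite -exprSr -addn1.
have deltaQ : delta ^+ Q != delta.
  by move: hdelta; rewrite (mem_divring_closed F FQ) // FQ_card.
have evalE x : ('X^(n + k * (Q + 1)) *
    ((delta *: 'X^(Q - 1) - (beta * delta ^+ Q)%:P) ^+ n
     - delta *: ('X^(Q - 1) - beta%:P) ^+ n)).[x]
    = twisted_power F Q n k beta delta x.
  rewrite !hornerE /twisted_power /twisted_form expr1n.
  (* The factor [x ^+ n] is moved into the two [n]-th powers. This identity holds at [x = 0] too, so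
     no case split is needed. *)
  have xQ : x ^+ (Q - 1) * x = x ^+ Q by rewrite -exprSr -addn1 subnK // ltnW.
  rewrite exprD mulnC exprM addn1 exprSr -xQ [x ^+ n * _]mulrC -[LHS]mulrA.
  congr (_ * _); rewrite mulrBr [x ^+ n * (delta * _)]mulrCA -!exprMn.
  by congr (_ ^+ n - delta * _ ^+ n); ring.
have -> : gcdn (n * (n + 2 * k)) (Q - 1) = 1%N <->
    coprime n (Q - 1) /\ coprime (n + 2 * k) (Q - 1).
  by rewrite (rwP andP) -coprimeMl; apply: (rwP eqP).
split=> [[h fK _]|[co_n co_nk]].
  apply: (@twisted_power_inj_coprime F Q n k beta delta) => // x y.
  by rewrite -!evalE => /(can_inj fK).
apply: injF_bij => x y /=; rewrite !evalE.
exact: twisted_power_inj.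
Qed.
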